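(* Let $L^{(1)},L^{(2)}:\mathbb{R}^k\times[k]\to\mathbb{R}\cup\{+\infty\}$ be bounded below losses, and for $i=1,2$ let $H_{L^{(i)}}(\pi)=\inf_{\alpha\in\mathbb{R}^k}\sum_{y=1}^k\pi_yL^{(i)}(\alpha,y)$, $\pi\in\Delta_k$, be the associated generalized entropies. Then $L^{(1)}$ and $L^{(2)}$ are universally equivalent with respect to all priors $\pi\in\Delta_k$ if and only if there exist $a>0$, $b\in\mathbb{R}^k$, and $c\in\mathbb{R}$ such that for all $\pi\in\Delta_k$, $$H_{L^{(1)}}(\pi)=aH_{L^{(2)}}(\pi)+b^T\pi+c.$$
   Context: $[k]=\{1,\ldots,k\}$, $\Delta_k=\{p\in\mathbb{R}^k_+ : \mathbf{1}^Tp=1\}$. Given a prior $\pi\in\Delta_k$ and probability distributions $P_1,\ldots,P_k$ on a measurable space $\mathcal{X}$, draw $Y\in[k]$ with $\mathbb{P}(Y=y)=\pi_y$ and, conditional on $Y=y$, $X\sim P_y$. A quantizer is a measurable map $\mathsf{q}:\mathcal{X}\to\mathcal{Z}$ into a measurable space $\mathcal{Z}$; $\widetilde\pi(\mathsf{q}(X))\in\Delta_k$ is the posterior distribution of $Y$ given $\mathsf{q}(X)$. For a loss $L$ with entropy $H_L(\pi)=\inf_\alpha\sum_y\pi_yL(\alpha,y)$, the quantized statistical information is $I(\pi,P_{1:k};H_L,\mathsf{q})=H_L(\pi)-\mathbb{E}[H_L(\widetilde\pi(\mathsf{q}(X)))]$. Losses $L^{(1)},L^{(2)}$ are universally equivalent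 for the prior $\pi$ if for any distributions $P_1,\ldots,P_k$ (on any $\mathcal{X}$) and any quantizers $\mathsf{q}_1,\mathsf{q}_2$ of $\mathcal{X}$: $I(\pi,P_{1:k};H_{L^{(1)}},\mathsf{q}_1)\le I(\pi,P_{1:k};H_{L^{(1)}},\mathsf{q}_2)$ if and only if $I(\pi,P_{1:k};H_{L^{(2)}},\mathsf{q}_1)\le I(\pi,P_{1:k};H_{L^{(2)}},\mathsf{q}_2)$.
   Formalization: The formal theorem additionally assumes that both generalized entropies are finite (less than +∞) at every prior in the simplex; otherwise the statistical information is ∞ − ∞ and undefined (for example when the first loss is identically +∞ and the second is 0). *)

(* Defs.v *)
From HB Require Import structures.
From mathcomp Require Import all_boot all_order all_algebra.
From mathcomp Require Import all_classical all_reals all_analysis.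
From mathcomp Require Import measurable_realfun.

Set Implicit Arguments.
Unset Strict Implicit.
Unset Printing Implicit Defensive.
Import Order.TTheory GRing.Theory Num.Theory.
Import numFieldNormedType.Exports.

Local Open Scope classical_set_scope.
Local Open Scope ring_scope.

Definition simplex (R : realType) (k : nat) : set 'rV[R]_k :=
  [set p | (forall y, 0 <= p ord0 y) /\ \sum_(y < k) p ord0 y = 1].
Arguments simplex : clear implicits.

Definition bounded_below (R : realType) (k : nat)
    (L : 'rV[R]_k -> 'I_k -> \bar R) : Prop :=
  exists m : R, forall alpha y, (m%:E <= L alpha y)%E.

(* H_L(pi), valued in the extended reals, with 0 * +oo = 0 in the sum. *)
Definition entropy (R : realType) (k : nat)
    (L : 'rV[R]_k -> 'I_k -> \bar R) (pi : 'rV[R]_k) : \bar R :=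
  ereal_inf (range (fun alpha : 'rV[R]_k =>
    (\sum_(y < k) (pi ord0 y)%:E * L alpha y)%E)).

(* E[g(X)] under the joint law P(Y = y, X \in A) = pi_y P_y(A). *)
Definition expectX (R : realType) (k : nat) (pi : 'rV[R]_k)
    (d : measure_display) (T : measurableType d)
    (P : 'I_k -> probability T R) (g : T -> \bar R) : \bar R :=
  (\sum_(y < k) (pi ord0 y)%:E * \int[P y]_x g x)%E.

(* t is a version of the conditional distribution of Y given q(X):
   E[t_y(q(X)) 1{q(X) \in B}] = P(Y = y, q(X) \in B). *)
Definition is_posterior (R : realType) (k : nat) (pi : 'rV[R]_k)
    (d : measure_display) (T : measurableType d)
    (P : 'I_k -> probability T R)
    (d' : measure_display) (Z : measurableType d') (q : T -> Z)
    (t : Z -> 'rV[R]_k) : Prop :=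
  [/\ forall z, simplex R k (t z),
      forall y, measurable_fun [set: Z] (fun z => t z ord0 y) &
      forall y (B : set Z), measurable B ->
        expectX pi P (fun x => (t (q x) ord0 y * \1_B (q x))%:E)
        = ((pi ord0 y)%:E * P y (q @^-1` B))%E].

Lemma is_posterior_exists (R : realType) (k : nat) (pi : 'rV[R]_k)
    (d : measure_display) (T : measurableType d)
    (P : 'I_k -> probability T R)
    (d' : measure_display) (Z : measurableType d') (q : T -> Z) :
  simplex R k pi -> measurable_fun [set: T] q ->
  exists t, is_posterior pi P q t.
Proof.
move=> [pi0 pi1] mq.
pose w y : {nonneg R} := NngNum (pi0 y).
pose m0 y : {measure set Z -> \bar R} := mscale (w y) (pushforward (P y) q).
pose m := m0 mq.
have mE y A : m y A = ((pi ord0 y)%:E * P y (q @^-1` A))%E by [].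
pose mn (n : nat) : {measure set Z -> \bar R} :=
  if insub n is Some y then m y else mzero.
pose M : {measure set Z -> \bar R} := msum mn k.
have mnE (y : 'I_k) : mn y = m y by rewrite /mn valK.
have ME A : M A = (\sum_(y < k) m y A)%E.
  by rewrite /M /= /msum; apply: eq_bigr => y _; rewrite mnE.
have mqB B : measurable B -> measurable (q @^-1` B).
  by move=> mB; rewrite -[X in measurable X]setTI; exact: (mq measurableT).
have finm y : fin_num_fun (m y).
  move=> A mA; rewrite mE fin_numM// fin_num_measure//; exact: mqB.
have finM : fin_num_fun M.
  by move=> A mA; rewrite ME; apply/sum_fin_numP => y _ _; exact: finm.
pose fm y : {finite_measure set Z -> \bar R} :=
  HB.pack_for {finite_measure set Z -> \bar R} (Measure.sort (m y))
    (Measure_isFinite.Build _ _ _ (m y) (finm y)).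
pose FM : {finite_measure set Z -> \bar R} :=
  HB.pack_for {finite_measure set Z -> \bar R} (Measure.sort M)
    (Measure_isFinite.Build _ _ _ M finM).
have expE (g : Z -> \bar R) : measurable_fun [set: Z] g -> (forall z, 0 <= g z)%E ->
    expectX pi P (fun x => g (q x)) = (\int[M]_z g z)%E.
  move=> mg g0; rewrite /M ge0_integral_measure_sum//.
  rewrite /expectX; apply: eq_bigr => y _.
  rewrite mnE /m ge0_integral_mscale//=.
  by rewrite ge0_integral_pushforward.
have dom y : fm y `<< FM.
  have H : forall A, measurable A -> M A = 0%E -> m y A = 0%E.
    move=> A mA; rewrite ME => /eqP; rewrite seq_psume_eq0// => /allP /(_ y).
    by rewrite mem_index_enum => /(_ isT) /eqP.
  by apply/null_content_dominatesP.
have /choice [f fP] : forall y, exists f : Z -> \bar R,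
    [/\ forall x, (f x >= 0)%E, forall x, f x \is a fin_num,
    FM.-integrable [set: Z] f &
    forall A, measurable A -> fm y A = (\int[FM]_(x in A) f x)%E].
  by move=> y; exact: radon_nikodym_sigma_finite (dom y).
have f0 y z : (0 <= f y z)%E by have [] := fP y.
have ffin y z : f y z \is a fin_num by have [] := fP y.
have fint y : FM.-integrable [set: Z] (f y) by have [] := fP y.
have mf y : measurable_fun [set: Z] (f y) by exact: measurable_int (fint y).
have fI y A : measurable A -> (\int[M]_(x in A) f y x)%E = m y A.
  by move=> mA; have [_ _ _ H] := fP y; exact: (esym (H A mA)).
pose s z := (\sum_(y < k) f y z)%E.
have ms : measurable_fun [set: Z] s by exact: emeasurable_sum.
have s1 : ae_eq FM setT (cst 1%E) s.
  apply: integral_ae_eq => //.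
    exact/finite_measure_integrable_cst.
  move=> E _ mE'; rewrite integral_cst// mul1e.
  rewrite ge0_integral_sum//; last by move=> y; exact: measurable_funTS.
  rewrite [LHS]ME; apply: eq_bigr => y _; exact/esym/fI.
pose g y z := if (s z == 1)%E then fine (f y z) else pi ord0 y.
exists (fun z => \row_y g y z).
have mg y : measurable_fun [set: Z] (g y).
  apply: measurable_fun_ifT => //; last exact: measurableT_comp.
  apply: (measurable_fun_bool true).
  rewrite (_ : _ @^-1` _ = s @^-1` [set 1%E]); last first.
    by apply/seteqP; split => z /= /eqP.
  exact: (ms measurableT _ (emeasurable_set1 1%E)).
have g0 y z : 0 <= g y z by rewrite /g; case: ifP => // _; exact: (fine_ge0 (f0 y z)).
split.
- move=> z; split => [y|]; first by rewrite mxE.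
  under eq_bigr do rewrite mxE.
  rewrite /g.
  case: (boolP (s z == 1%E)) => [/eqP sz|_]; last by [].
  by apply: EFin_inj; rewrite -sumEFin -sz; apply: eq_bigr => y _; rewrite fineK.
- move=> y; under eq_fun do rewrite mxE.
  exact: mg.
- move=> y B mB.
  rewrite (expE (fun z => ((\row_y0 g y0 z) ord0 y * \1_B z)%:E)); last 2 first.
  + apply/measurable_EFinP; apply: measurable_funM => //.
    under eq_fun do rewrite mxE.
    exact: mg.
  + by move=> z; rewrite lee_fin mulr_ge0// mxE.
  rewrite -mE -fI// [RHS]integral_mkcond.
  apply: (@ge0_ae_eq_integral _ _ _ FM) => //.
  + apply/measurable_EFinP; apply: measurable_funM => //.
    under eq_fun do rewrite mxE.
    exact: mg.
  + by apply/(measurable_restrictT _ mB); exact: measurable_funTS.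
  + by move=> z _; rewrite lee_fin mulr_ge0// mxE.
  + by move=> z _; exact: erestrict_ge0.
  + apply: filterS s1 => z /= sz _; rewrite mxE /g -sz// eqxx patchE indicE.
    by case: ifP => _; rewrite ?mulr1 ?mulr0 ?fineK.
Qed.

(* The posterior is unique up to null sets of the law of q(X); one version is
   chosen. By posteriorP the default value of xget is irrelevant. *)
Definition posterior (R : realType) (k : nat) (pi : 'rV[R]_k)
    (d : measure_display) (T : measurableType d)
    (P : 'I_k -> probability T R)
    (d' : measure_display) (Z : measurableType d') (q : T -> Z) :
    Z -> 'rV[R]_k :=
  xget (fun=> pi) [set t | is_posterior pi P q t].

Lemma posteriorP (R : realType) (k : nat) (pi : 'rV[R]_k)
    (d : measure_display) (T : measurableType d)
    (P : 'I_k -> probability T R)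
    (d' : measure_display) (Z : measurableType d') (q : T -> Z) :
  simplex R k pi -> measurable_fun [set: T] q ->
  is_posterior pi P q (posterior pi P q).
Proof.
move=> pi_simplex mq; rewrite /posterior.
case: xgetP => [//|noex].
by have [t tP] := is_posterior_exists P pi_simplex mq; case: (noex t).
Qed.

Definition information (R : realType) (k : nat) (pi : 'rV[R]_k)
    (d : measure_display) (T : measurableType d)
    (P : 'I_k -> probability T R) (H : 'rV[R]_k -> \bar R)
    (d' : measure_display) (Z : measurableType d') (q : T -> Z) : \bar R :=
  (H pi - expectX pi P (fun x => H (posterior pi P q (q x))))%E.

Definition universally_equivalent (R : realType) (k : nat)
    (L1 L2 : 'rV[R]_k -> 'I_k -> \bar R) (pi : 'rV[R]_k) : Prop :=
  forall (d : measure_display) (T : measurableType d)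
    (P : 'I_k -> probability T R)
    (d1 : measure_display) (Z1 : measurableType d1) (q1 : T -> Z1)
    (d2 : measure_display) (Z2 : measurableType d2) (q2 : T -> Z2),
  measurable_fun [set: T] q1 -> measurable_fun [set: T] q2 ->
  ((information pi P (entropy L1) q1 <= information pi P (entropy L1) q2)%E
   <->
   (information pi P (entropy L2) q1 <= information pi P (entropy L2) q2)%E).

(* Main.v *)
Require Import Defs.
From HB Require Import structures.
From mathcomp Require Import all_boot all_order all_algebra.
From mathcomp Require Import all_classical all_reals all_analysis.
From mathcomp Require Import measurable_realfun ring lra.

Set Implicit Arguments.
Unset Strict Implicit.
Unset Printing Implicit Defensive.
Import Order.TTheory GRing.Theory Num.Theory.
Import numFieldNormedType.Exports.
Local Open Scope classical_set_scope.
Local Open Scope ring_scope.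

(** Why the theorem is true.

    An affine relation [H1 = a H2 + b.p + c] is inherited by the information:
    the posterior averages to the prior, so the affine part contributes the
    same amount to [H1 pi] and to [E H1], cancels in the difference, and
    [I1 = a I2] with [0 < a] ([information_affine]).  What has to be checked is
    that [H o posterior] is integrable.  An entropy need not be continuous on
    the simplex, because losses may be infinite; it is Borel nevertheless.  For
    a nonnegative loss the formula for the entropy makes sense on the whole
    orthant and is monotone and positively homogeneous there, so that
    [H u > r] is witnessed by a rational vector below [u]
    ([entropy_gt_rat]).  A loss bounded below is reduced to this case by
    subtracting a constant.

    Conversely, call [gap L p = H p - \sum_y p_y H(e_y)] the distance from [H]
    to its linear interpolation at the vertices.  It is nonnegative, and the
    affine relation says exactly that [gap L1 = a gap L2].  Given [p], [r] in
    the simplex and positive weights [s + t = 1], take the prior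
    [s p + t r] and an observation [X] made of [Y] itself and of a coin, where
    the coin tells from which of the two components [Y] was drawn.  One
    quantizer forgets [Y] on the [p] branch, the other on the [r] branch, and
    both keep it otherwise.  Their expected posterior entropies are
    [s H p + t \sum_y r_y H(e_y)] and [t H r + s \sum_y p_y H(e_y)], so
    comparing their informations amounts to comparing [s gap L p] with
    [t gap L r] ([universally_equivalent_gap]).  Choosing [s] and [t] that
    equalize the two sides for [L2] equalizes them for [L1], and the ratio
    [gap L1 / gap L2] is constant ([proportional_of_compare]). *)

(** * Entropies: regularity *)

Section entropy_orthant.
Context (R : realType) (k : nat) (L : 'rV[R]_k -> 'I_k -> \bar R).
Hypothesis L0 : forall alpha y, (0 <= L alpha y)%E.
Implicit Types u v : 'rV[R]_k.

Lemma le_entropy u v :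
  (forall y, u ord0 y <= v ord0 y) -> (entropy L u <= entropy L v)%E.
Proof.
move=> uv; apply/ereal_infP => _ [alpha _ <-].
apply: ge_ereal_inf; exists (\sum_(y < k) (u ord0 y)%:E * L alpha y)%E.
  by exists alpha.
by apply: lee_sum => y _; rewrite lee_wpmul2r// lee_fin.
Qed.

Lemma ge_entropy_scale (c : R) u : 0 <= c -> (forall y, 0 <= u ord0 y) ->
  (c%:E * entropy L u <= entropy L (c *: u))%E.
Proof.
move=> c0 u0; apply/ereal_infP => _ [alpha _ <-].
under eq_bigr do rewrite mxE EFinM -muleA.
rewrite -ge0_sume_distrr; last by move=> y _; rewrite mule_ge0// lee_fin.
apply: lee_wpmul2l; first by rewrite lee_fin.
by apply: ereal_inf_lbound; exists alpha.
Qed.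

Lemma entropy_ge0 u : (forall y, 0 <= u ord0 y) -> (0 <= entropy L u)%E.
Proof.
move=> u0; apply/ereal_infP => _ [alpha _ <-].
by apply: sume_ge0 => y _; rewrite mule_ge0// lee_fin.
Qed.

(** Homogeneity lets one shrink [u] slightly and still exceed [r]; this makes
    room for a rational vector between the shrunk vector and [u], to which
    monotonicity applies.  No continuity of the entropy is used: it may jump
    at the boundary of the orthant. *)
Lemma entropy_gt_rat u (r : R) : 0 <= r -> (forall y, 0 <= u ord0 y) ->
  (r%:E < entropy L u)%E ->
  exists2 v : 'rV[rat]_k, (forall y, ratr (v ord0 y) <= u ord0 y) &
    (r%:E < entropy L (map_mx ratr v))%E.
Proof.
move=> r0 u0 ru.
have [c /andP[c0 c1] rc] : exists2 c : R,
    0 < c < 1 & (r%:E < c%:E * entropy L u)%E.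
  case: (entropy L u) ru => [h| |//] ru.
    have h0 : 0 < h by rewrite (le_lt_trans r0)// -lte_fin.
    have /midf_lt[] : r / h < 1 by rewrite ltr_pdivrMr// mul1r -lte_fin.
    set c := _ / 2 => rc c1; exists c.
      by rewrite c1 (le_lt_trans _ rc)// divr_ge0// ltW.
    by rewrite -EFinM lte_fin -ltr_pdivrMr.
  exists (1 / 2); last by rewrite gt0_muley ?lte_fin ?ltry.
  by rewrite divr_gt0//= ltr_pdivrMr// mul1r ltrDl.
have /choice[v vP] : forall y, exists w : rat,
    c * u ord0 y <= ratr w <= u ord0 y.
  move=> y; have [uy|] := ltP 0 (u ord0 y).
    have /rat_in_itvoo[w] : c * u ord0 y < u ord0 y by rewrite gtr_pMl.
    by rewrite in_itv/= => /andP[/ltW ? /ltW ?]; exists w; apply/andP.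
  (* There is no room at a zero coordinate, but zero is itself rational. *)
  move=> uy; have -> : u ord0 y = 0 by apply/eqP; rewrite eq_le uy u0.
  by exists 0; rewrite raddf0 mulr0 lexx.
exists (\row_y v y) => [y|]; first by rewrite mxE; case/andP: (vP y).
apply: lt_le_trans rc _; apply: le_trans (ge_entropy_scale (ltW c0) u0) _.
by apply: le_entropy => y; rewrite !mxE; case/andP: (vP y).
Qed.

(** The set where [entropy L (t z)] exceeds [r] is the union, over the
    countably many rational [v] with entropy exceeding [r], of the sets where
    [t z] dominates [v]. *)
Lemma measurable_entropy_ge0 d (Z : measurableType d) (t : Z -> 'rV[R]_k) :
  (forall z y, 0 <= t z ord0 y) ->
  (forall y, measurable_fun [set: Z] (fun z => t z ord0 y)) ->
  measurable_fun [set: Z] (fun z => entropy L (t z)).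
Proof.
move=> t0 mt mZ; apply: (measurability _ (ErealGenOInfty.measurableE R)) => //.
move=> _ [_ [r ->] <-]; rewrite setTI.
have [r0|r0] := ltP r 0.
  rewrite (_ : _ @^-1` _ = setT)//; apply/seteqP; split => // z _ /=.
  by rewrite in_itv/= andbT (lt_le_trans _ (entropy_ge0 (t0 z)))// lte_fin.
pose B (v : 'rV[rat]_k) :=
  if (r%:E < entropy L (map_mx ratr v))%E
  then \bigcap_(y in [set: 'I_k]) [set z | ratr (v ord0 y) <= t z ord0 y]
  else set0.
rewrite (_ : _ @^-1` _ = \bigcup_v B v).
  apply: countable_bigcupT_measurable => // v; rewrite /B; case: ifP => // _.
  apply: fin_bigcap_measurable => // y _.
  rewrite -[X in measurable X]setTI.
  rewrite (_ : [set z | _] =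
      (fun z => t z ord0 y) @^-1` `[ratr (v ord0 y), +oo[).
    exact: (mt y).
  by apply/seteqP; split => z /=; rewrite in_itv/= andbT.
apply/seteqP; split => z /=.
  rewrite in_itv/= andbT => /(entropy_gt_rat r0 (t0 z))[v vt rv].
  by exists v => //; rewrite /B rv => y _; exact: vt.
rewrite in_itv/= andbT => -[v _]; rewrite /B; case: ifP => // rv vt.
by apply: lt_le_trans rv _; apply: le_entropy => y; rewrite mxE; exact: vt.
Qed.

Lemma entropy_le_ones u : (forall y, u ord0 y <= 1) ->
  (entropy L u <= entropy L (const_mx 1%R))%E.
Proof. by move=> u1; apply: le_entropy => y; rewrite mxE. Qed.

End entropy_orthant.

Section entropy_simplex.
Context (R : realType) (k : nat) (L : 'rV[R]_k -> 'I_k -> \bar R).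
Hypotheses (L_bounded : bounded_below L)
  (L_fin : forall p, simplex R k p -> (entropy L p < +oo)%E).

Lemma simplex_le1 (p : 'rV[R]_k) y : simplex R k p -> p ord0 y <= 1.
Proof.
move=> [p0 <-]; rewrite (bigD1 y)//= lerDl; apply: sumr_ge0 => z _; exact: p0.
Qed.

Lemma entropy_shift (m : R) (p : 'rV[R]_k) : simplex R k p ->
  entropy L p = (entropy (fun alpha y => L alpha y - m%:E) p + m%:E)%E.
Proof.
move=> [p0 p1].
have E alpha : (\sum_(y < k) (p ord0 y)%:E * (L alpha y - m%:E))%E =
    (\sum_(y < k) (p ord0 y)%:E * L alpha y - m%:E)%E.
  under eq_bigr => y _ do rewrite muleBr ?fin_num_adde_defl// -EFinM -EFinN.
  rewrite big_split/= sumEFin; congr (_ + _%:E)%E.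
  by rewrite sumrN -mulr_suml p1 mul1r.
apply/eqP; rewrite eq_le; apply/andP; split.
  rewrite -leeBlDr//; apply/ereal_infP => _ [alpha _ <-].
  by rewrite E leeB//; apply: ereal_inf_lbound; exists alpha.
apply/ereal_infP => _ [alpha _ <-]; rewrite -leeBrDr//.
by apply: ereal_inf_lbound; exists alpha.
Qed.

Lemma entropy_fin_num (p : 'rV[R]_k) :
  simplex R k p -> entropy L p \is a fin_num.
Proof.
move=> sp; have [m mL] := L_bounded.
rewrite fin_numElt L_fin// andbT.
rewrite (entropy_shift m sp) (@lt_le_trans _ _ m%:E)// ?ltNyr// leeDr//.
by apply: entropy_ge0 => [alpha y|]; [rewrite sube_ge0|case: sp].
Qed.

Lemma fine_entropyK (p : 'rV[R]_k) :
  simplex R k p -> (fine (entropy L p))%:E = entropy L p.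
Proof. by move=> sp; rewrite fineK// entropy_fin_num. Qed.

Lemma measurable_entropy d (Z : measurableType d) (t : Z -> 'rV[R]_k) :
  (forall z, simplex R k (t z)) ->
  (forall y, measurable_fun [set: Z] (fun z => t z ord0 y)) ->
  measurable_fun [set: Z] (fun z => entropy L (t z)).
Proof.
move=> st mt; have [m mL] := L_bounded.
under eq_fun do rewrite (entropy_shift m)//.
apply: emeasurable_funD => //; apply: measurable_entropy_ge0 => //.
  by move=> alpha y; rewrite sube_ge0.
by move=> z y; case: (st z).
Qed.

(** After the shift to a nonnegative loss, monotonicity bounds the entropy on
    the simplex by its value at the all-ones vector, which by homogeneity is
    controlled by the entropy of the uniform distribution. *)
Lemma bounded_entropy :
  exists C : R, forall p, simplex R k p -> (`|entropy L p| <= C%:E)%E.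
Proof.
have [k0|/eqP k0] := eqVneq k 0.
  exists 0 => p [_]; rewrite big1; first by move/eqP; rewrite eq_sym oner_eq0.
  by move=> y; move: (ltn_ord y); rewrite [in X in (_ < X)%N]k0.
have [m mL] := L_bounded.
pose K alpha y := (L alpha y - m%:E)%E.
have K0 alpha y : (0 <= K alpha y)%E by rewrite sube_ge0.
pose one : 'rV[R]_k := const_mx 1.
have kr : 0 < (k%:R : R) by rewrite ltr0n lt0n; exact/eqP.
have su : simplex R k (k%:R^-1 *: one).
  split=> [y|]; first by rewrite !mxE mulr1 invr_ge0 ltW.
  under eq_bigr do rewrite !mxE mulr1.
  by rewrite sumr_const card_ord -[LHS]mulr_natl divff// gt_eqF.
have K1 : entropy K one \is a fin_num.
  rewrite ge0_fin_numE; last by apply: entropy_ge0 => // y; rewrite mxE.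
  have := L_fin su; rewrite (entropy_shift m su) => Hu.
  have one0 y : 0 <= one ord0 y by rewrite mxE.
  have kV0 : 0 <= (k%:R^-1 : R) by rewrite invr_ge0 ltW.
  have := ge_entropy_scale K0 kV0 one0; rewrite -/K in Hu.
  case: (eqVneq (entropy K one) +oo%E) => [->|]; last by rewrite ltey.
  rewrite gt0_muley ?lte_fin ?invr_gt0// leye_eq => /eqP h.
  by move: Hu; rewrite h.
exists (fine (entropy K one) + `|m|) => p sp.
rewrite (entropy_shift m sp) -/K EFinD fineK//.
apply: le_trans (lee_abs_add _ _) _; apply: leeD => //.
rewrite gee0_abs; last by apply: entropy_ge0 => //; case: sp.
by apply: entropy_le_ones => // y; apply: simplex_le1 sp.
Qed.

Lemma integrable_entropy d (T : measurableType d) (P : probability T R)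
    (t : T -> 'rV[R]_k) :
  (forall x, simplex R k (t x)) ->
  (forall y, measurable_fun [set: T] (fun x => t x ord0 y)) ->
  P.-integrable [set: T] (fun x => entropy L (t x)).
Proof.
move=> st mt; have [C LC] := bounded_entropy.
apply: (le_integrable measurableT (g := EFin \o cst C)).
- exact: measurable_entropy.
- by move=> x _ /=; rewrite (le_trans (LC _ (st x)))// lee_fin ler_norm.
- exact: finite_measure_integrable_cst.
Qed.

End entropy_simplex.

(** * Invariance of the comparison under affine changes *)

Section expectX_linear.
Context (R : realType) (k : nat) (pi : 'rV[R]_k) d (T : measurableType d)
  (P : 'I_k -> probability T R).
Implicit Types f g : T -> \bar R.

Lemma expectX_fin_num f : (forall y, (P y).-integrable [set: T] f) ->
  expectX pi P f \is a fin_num.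
Proof.
move=> fi; apply/sum_fin_numP => y _ _; rewrite fin_numM//.
by have := integrable_fin_num measurableT (fi y).
Qed.

Lemma expectXD f g : (forall y, (P y).-integrable [set: T] f) ->
  (forall y, (P y).-integrable [set: T] g) ->
  expectX pi P (fun x => f x + g x)%E = (expectX pi P f + expectX pi P g)%E.
Proof.
move=> fi gi; rewrite /expectX -big_split; apply: eq_bigr => y _ /=.
rewrite integralD//; [|exact: (fi y)|exact: (gi y)].
rewrite muleDr// fin_num_adde_defl//.
by have := integrable_fin_num measurableT (gi y).
Qed.

Lemma expectXZ (a : R) f : (forall y, (P y).-integrable [set: T] f) ->
  expectX pi P (fun x => a%:E * f x)%E = (a%:E * expectX pi P f)%E.
Proof.
move=> fi; rewrite /expectX fin_num_sume_distrr//; last first.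
  move=> i j _ _; rewrite fin_num_adde_defl// fin_numM//.
  by have := integrable_fin_num measurableT (fi j).
by apply: eq_bigr => y _; rewrite integralZl//; [exact: muleCA|exact: (fi y)].
Qed.

Lemma expectX_sum (I : finType) (f : I -> T -> \bar R) :
  (forall i y, (P y).-integrable [set: T] (f i)) ->
  expectX pi P (fun x => \sum_i f i x)%E = (\sum_i expectX pi P (f i))%E.
Proof.
move=> fi; rewrite /expectX exchange_big; apply: eq_bigr => y _.
rewrite integral_sum//; last by move=> i; exact: (fi i y).
rewrite fin_num_sume_distrr// => i j _ _; rewrite fin_num_adde_defl//.
by have := integrable_fin_num measurableT (fi j y).
Qed.

End expectX_linear.

Section affine_invariance.
Context (R : realType) (k : nat) (pi : 'rV[R]_k) d (T : measurableType d)
  (P : 'I_k -> probability T R) d' (Z : measurableType d') (q : T -> Z).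
Hypotheses (spi : simplex R k pi) (mq : measurable_fun [set: T] q).
Let t := posterior pi P q.

Lemma posterior_simplex z : simplex R k (t z).
Proof. by have [] := posteriorP P spi mq. Qed.

Lemma measurable_posterior y :
  measurable_fun [set: T] (fun x => t (q x) ord0 y).
Proof.
have [_ mt _] := posteriorP P spi mq.
exact: (measurableT_comp (mt y)).
Qed.

Lemma integrable_posterior y' y :
  (P y').-integrable [set: T] (fun x => (t (q x) ord0 y)%:E).
Proof.
apply: (le_integrable measurableT (g := EFin \o cst 1)).
- by apply/measurable_EFinP; exact: measurable_posterior.
- move=> x _ /=; have st := posterior_simplex (q x).
  by rewrite lee_fin normr1 ger0_norm ?simplex_le1//; case: st.
- exact: finite_measure_integrable_cst.
Qed.

(** The martingale property of the posterior: test its defining identity on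
    the whole space. *)
Lemma expectX_posterior y :
  expectX pi P (fun x => (t (q x) ord0 y)%:E) = (pi ord0 y)%:E.
Proof.
have [_ _ /(_ y setT measurableT)] := posteriorP P spi mq.
rewrite preimage_setT probability_setT mule1 => <-.
by congr expectX; apply/funext => x; rewrite indicT mulr1.
Qed.

Lemma expectX_posterior_affine (b : 'rV[R]_k) (c : R) :
  expectX pi P (fun x => (\sum_(y < k) b ord0 y * t (q x) ord0 y + c)%:E) =
  (\sum_(y < k) b ord0 y * pi ord0 y + c)%:E.
Proof.
(* On the simplex a constant is linear: [c = \sum_y c p_y]. *)
have affE p : simplex R k p -> (\sum_(y < k) b ord0 y * p ord0 y + c)%:E =
    (\sum_(y < k) (b ord0 y + c)%:E * (p ord0 y)%:E)%E.
  move=> [_ p1]; rewrite -[c in LHS]mulr1 -p1 mulr_sumr -big_split/= -sumEFin.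
  by apply: eq_bigr => y _; rewrite -mulrDl EFinM.
under [in LHS]eq_fun do rewrite (affE _ (posterior_simplex _)).
rewrite affE// expectX_sum; last first.
  by move=> y y'; apply: integrableZl => //; exact: integrable_posterior.
apply: eq_bigr => y _; rewrite expectXZ ?expectX_posterior// => y'.
exact: integrable_posterior.
Qed.

Lemma integrable_entropy_posterior (L : 'rV[R]_k -> 'I_k -> \bar R) y :
  bounded_below L -> (forall p, simplex R k p -> (entropy L p < +oo)%E) ->
  (P y).-integrable [set: T] (fun x => entropy L (t (q x))).
Proof.
move=> Lb Lf; apply: integrable_entropy => // [x|y'].
  exact: posterior_simplex.
exact: measurable_posterior.
Qed.

Lemma information_affine (L1 L2 : 'rV[R]_k -> 'I_k -> \bar R)
    (a : R) (b : 'rV[R]_k) (c : R) :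
  bounded_below L2 -> (forall p, simplex R k p -> (entropy L2 p < +oo)%E) ->
  (forall p, simplex R k p -> entropy L1 p =
    (a%:E * entropy L2 p + (\sum_(y < k) b ord0 y * p ord0 y + c)%:E)%E) ->
  information pi P (entropy L1) q = (a%:E * information pi P (entropy L2) q)%E.
Proof.
move=> L2b L2f HE; rewrite /information HE//.
under [X in expectX _ _ X]eq_fun do rewrite (HE _ (posterior_simplex _)).
have iH y : (P y).-integrable [set: T] (fun x => entropy L2 (t (q x))).
  exact: integrable_entropy_posterior.
rewrite expectXD; last 2 first.
- by move=> y; apply: (integrableZl _ _ (iH y)).
- move=> y; under eq_fun do rewrite EFinD -sumEFin.
  apply: integrableD => //; last exact: finite_measure_integrable_cst.
  apply: integrable_sum => // y' _; under eq_fun do rewrite EFinM.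
  by apply: integrableZl => //; exact: integrable_posterior.
rewrite expectXZ// expectX_posterior_affine.
rewrite -(fine_entropyK L2b L2f spi) -(fineK (expectX_fin_num pi iH)).
by rewrite -!(EFinN, EFinM, EFinD); congr EFin; ring.
Qed.

End affine_invariance.

(** * An experiment revealing the label and a coin *)

Section integral_bernoulli_fin_num.
Context (R : realType) (w : R).
Hypothesis w01 : 0 <= w <= 1.
Variable f : bool -> \bar R.
Hypothesis ffin : forall c, f c \is a fin_num.

Lemma integrable_bernoulli_fin_num :
  (bernoulli_prob w).-integrable [set: bool] f.
Proof.
apply/integrableP; split; first by [].
rewrite integral_bernoulli_prob//.
by rewrite -(fineK (ffin true)) -(fineK (ffin false)) -!(EFinM, EFinD) ltry.
Qed.

Lemma integral_bernoulli_fin_num :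
  (\int[bernoulli_prob w]_c f c =
   w%:E * f true + (1 - w)%:E * f false)%E.
Proof.
rewrite integralE !integral_bernoulli_prob// !funeposE !funenegE.
rewrite -(fineK (ffin true)) -(fineK (ffin false)) /=.
set a := fine _; set b := fine _.
rewrite -!(EFinN, EFinM, EFinD, EFin_max); congr EFin.
have H x : x = Num.max x 0 - Num.max (- x) 0 :> R.
  by rewrite !maxEle oppr_le0; case: leP => [?|/ltW ?]; case: leP; lra.
rewrite [X in _ = w * X + _]H [X in _ = _ + _ * X]H /unstable.onem; ring.
Qed.

End integral_bernoulli_fin_num.

(** [m c y] is the joint mass of the label [y] and the coin [c].  Given the
    label, the coin is Bernoulli and the observation is the pair.  Labels are
    stored as natural numbers, whose sigma-algebra is discrete. *)
Section coin_experiment.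
Context (R : realType) (k : nat) (m : bool -> 'I_k -> R).
Hypothesis m0 : forall c y, 0 <= m c y.
Let pi : 'rV[R]_k := \row_y (m true y + m false y).

Definition reveal (y : 'I_k) (c : bool) : nat * bool := (nat_of_ord y, c).

Lemma measurable_reveal y : measurable_fun [set: bool] (reveal y).
Proof. by []. Qed.

HB.instance Definition _ y :=
  isMeasurableFun.Build _ _ _ _ (reveal y) (measurable_reveal y).

Let w y := m true y / (m true y + m false y).

Definition coin_law y : probability (nat * bool)%type R :=
  distribution (bernoulli_prob (w y)) (reveal y).

Lemma coin_weight01 y : 0 <= w y <= 1.
Proof.
have := m0 true y; have := m0 false y; rewrite /w => f0 t0.
rewrite divr_ge0 ?addr_ge0//=.
have [->|s0] := eqVneq (m true y + m false y) 0; first by rewrite invr0 mulr0.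
by rewrite ler_pdivrMr ?mul1r ?lerDl// lt0r s0 addr_ge0.
Qed.

(** This holds also for a label of prior mass zero, where the
    conditional law of the coin is arbitrary: both sides vanish. *)
Lemma coin_weight_true y : pi ord0 y * w y = m true y.
Proof.
rewrite mxE /w.
have [s0|s0] := eqVneq (m true y + m false y) 0; last by rewrite mulrC divfK.
by rewrite s0 mul0r; have := m0 true y; have := m0 false y; lra.
Qed.

Lemma coin_weight_false y : pi ord0 y * (1 - w y) = m false y.
Proof. by rewrite mulrBr coin_weight_true mxE mulr1; lra. Qed.

Lemma expectX_coin (b : bool) (g : nat * bool -> \bar R) :
  measurable_fun [set: nat * bool] g -> (forall x, g x \is a fin_num) ->
  expectX pi coin_law g =
  (\sum_(y < k) ((m b y)%:E * g (nat_of_ord y, b)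
                 + (m (~~ b) y)%:E * g (nat_of_ord y, ~~ b)))%E.
Proof.
move=> mg gfin; apply: eq_bigr => y _.
have w01 := coin_weight01 y.
rewrite integral_distribution//; last first.
  by apply: (integrable_bernoulli_fin_num w01) => c; exact: gfin.
rewrite integral_bernoulli_fin_num//= /reveal.
rewrite -(fineK (gfin (nat_of_ord y, true))).
rewrite -(fineK (gfin (nat_of_ord y, false))).
rewrite -!(EFinM, EFinD) mulrDr (mulrA _ (w y)) (mulrA _ (1 - w y)).
rewrite coin_weight_true coin_weight_false.
rewrite EFinD !EFinM !fineK//.
by case: b => //=; rewrite addeC.
Qed.

Lemma coin_lawE (b : bool) y A :
  ((pi ord0 y)%:E * coin_law y A)%E =
  (m b y * \1_A (nat_of_ord y, b) + m (~~ b) y * \1_A (nat_of_ord y, ~~ b))%:E.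
Proof.
rewrite -[coin_law y A]/(bernoulli_prob (w y) (reveal y @^-1` A)).
rewrite bernoulli_probE ?coin_weight01//.
rewrite !diracE -!(EFinM, EFinD); congr EFin.
rewrite mulrDr (mulrA _ (w y)) (mulrA _ (1 - w y)).
rewrite coin_weight_true coin_weight_false !indicE.
by case: b => //=; rewrite addrC.
Qed.

(** [0] is the erased symbol, hence the shift of the labels that are kept. *)
Definition erase_branch (b : bool) (x : nat * bool) : nat :=
  if x.2 == b then 0%N else x.1.+1.

Lemma measurable_erase_branch b :
  measurable_fun [set: nat * bool] (erase_branch b).
Proof.
apply: measurable_fun_ifT => //.
  by apply: (measurableT_comp (f := fun c : bool => c == b)).
by apply: (measurableT_comp (f := S)).
Qed.

Lemma erase_branch_same b n : erase_branch b (n, b) = 0%N.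
Proof. by rewrite /erase_branch eqxx. Qed.

Lemma erase_branch_other b n : erase_branch b (n, ~~ b) = n.+1.
Proof. by case: b. Qed.

Hypothesis spi : simplex R k pi.

(** The erased symbol has mass [\sum_y m b y] and posterior the normalized
    branch [b]; any other symbol of positive mass identifies the label, so that
    its posterior is a vertex.  The posterior at symbols of mass zero is
    arbitrary and does not contribute. *)
Lemma information_coin (L : 'rV[R]_k -> 'I_k -> \bar R) b :
  bounded_below L -> (forall p, simplex R k p -> (entropy L p < +oo)%E) ->
  0 < \sum_y m b y ->
  information pi coin_law (entropy L) (erase_branch b) =
  (fine (entropy L pi) -
   ((\sum_y m b y) * fine (entropy L (\row_y (m b y / \sum_y' m b y'))) +
    \sum_y m (~~ b) y * fine (entropy L (delta_mx ord0 y))))%:E.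
Proof.
move=> Lb Lf s0; set s := \sum_y m b y in s0 *.
have mq := measurable_erase_branch b.
rewrite /information; set t := posterior _ _ _.
have [st _ tP] := posteriorP coin_law spi mq; rewrite -/t in st tP.
have Efin z : entropy L (t z) \is a fin_num by exact: entropy_fin_num.
(* The defining identity of the posterior, tested on the singleton [n]. *)
have key y (n : nat) :
    \sum_(j < k) (m b j * (t 0%N ord0 y * (0%N == n)%:R)
      + m (~~ b) j * (t j.+1 ord0 y * (j.+1 == n)%:R)) =
    m b y * (0%N == n)%:R + m (~~ b) y * (y.+1 == n)%:R.
  have indn j : \1_[set n] j = (j == n)%:R :> R.
    by rewrite indicE; congr (nat_of_bool _)%:R; apply/idP/eqP; rewrite inE.
  have := tP y [set n] I; rewrite (expectX_coin b)//; last first.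
    apply/measurable_EFinP.
    exact: (measurableT_comp (f := fun z => t z ord0 y * \1_[set n] z)).
  rewrite (coin_lawE b).
  have pre x :
      \1_(erase_branch b @^-1` [set n]) x = \1_[set n] (erase_branch b x).
    by [].
  rewrite !pre erase_branch_same erase_branch_other !indn.
  under eq_bigr do
    rewrite erase_branch_same erase_branch_other !indn -!EFinM -EFinD.
  by rewrite sumEFin => -[].
have t0 : t 0%N = \row_y (m b y / s).
  apply/rowP => y; rewrite mxE; have /= := key y 0%N.
  under eq_bigr do rewrite !mulr0 addr0 mulr1.
  rewrite -mulr_suml -/s mulr0 addr0 mulr1 => <-.
  by rewrite mulrC mulKf// gt_eqF.
have tS j : m (~~ b) j != 0 -> t j.+1 = delta_mx ord0 j.
  move=> mj; apply/rowP => y; rewrite mxE eqxx/=; have /= := key y j.+1.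
  under eq_bigr do rewrite !mulr0 add0r eqSS.
  rewrite (bigD1 j)//= big1 => [|i ij]; last first.
    by rewrite [_ == _ :> nat](negbTE ij) !mulr0.
  rewrite eqxx mulr0 add0r addr0 mulr1 eqSS => /(canRL (mulKf mj)) ->.
  have [->|yj] := eqVneq y j; first by rewrite eqxx mulr1 mulVf.
  by rewrite [_ == _ :> nat](negbTE yj) !mulr0.
rewrite (expectX_coin b)//; last first.
  by apply: (measurableT_comp (f := fun z => entropy L (t z))).
under eq_bigr => y _.
  rewrite erase_branch_same erase_branch_other t0.
  rewrite -[entropy L (\row_y _)]fineK; last by rewrite -t0.
  have -> : ((m (~~ b) y)%:E * entropy L (t y.+1) =
      (m (~~ b) y * fine (entropy L (delta_mx ord0 y)))%:E)%E.
    have [->|my] := eqVneq (m (~~ b) y) 0; first by rewrite mul0e mul0r.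
    by rewrite EFinM -tS// fineK.
  rewrite -EFinM -EFinD.
  over.
by rewrite sumEFin big_split/= -mulr_suml -/s EFinB fineK//;
  exact: entropy_fin_num.
Qed.

End coin_experiment.

(** * The concavity gap *)

Section concavity_gap.
Context (R : realType) (k : nat).
Implicit Types L : 'rV[R]_k -> 'I_k -> \bar R.

Lemma delta_simplex y : simplex R k (delta_mx ord0 y).
Proof.
split=> [j|]; first by rewrite mxE eqxx/= ler0n.
rewrite (bigD1 y)//= big1 ?addr0 => [|j jy]; first by rewrite mxE !eqxx.
by rewrite mxE eqxx (negbTE jy).
Qed.

Definition gap L (p : 'rV[R]_k) : R :=
  fine (entropy L p) -
  \sum_(y < k) p ord0 y * fine (entropy L (delta_mx ord0 y)).

(** The minimal risk under [p] is at least the risk when the label is known: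
    at a vertex the infimum is over a single coordinate of the loss. *)
Lemma gap_ge0 L p :
  bounded_below L -> (forall p, simplex R k p -> (entropy L p < +oo)%E) ->
  simplex R k p -> 0 <= gap L p.
Proof.
move=> Lb Lf sp; rewrite subr_ge0 -lee_fin fine_entropyK// -sumEFin.
apply/ereal_infP => _ [alpha _ <-]; apply: lee_sum => y _; rewrite EFinM.
apply: lee_wpmul2l; first by rewrite lee_fin; case: sp.
rewrite fine_entropyK//; last exact: delta_simplex.
apply: ereal_inf_lbound; exists alpha => //.
rewrite (bigD1 y)//= big1 ?adde0 => [|j jy]; first by rewrite mxE !eqxx mul1e.
by rewrite mxE eqxx (negbTE jy) mul0e.
Qed.

Lemma gap_delta L y : gap L (delta_mx ord0 y) = 0.
Proof.
rewrite /gap (bigD1 y)//= big1 ?addr0 => [|j jy].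
  by rewrite mxE !eqxx mul1r subrr.
by rewrite mxE eqxx (negbTE jy) mul0r.
Qed.

(** The coin experiment whose branches carry [s p] and [t r], with the
    quantizers erasing the label on one branch or on the other.  The prior
    entropy is common to both sides, and the rest rearranges into gaps. *)
Lemma universally_equivalent_gap L1 L2 (s t : R) (p r : 'rV[R]_k) :
  bounded_below L1 -> bounded_below L2 ->
  (forall p, simplex R k p -> (entropy L1 p < +oo)%E) ->
  (forall p, simplex R k p -> (entropy L2 p < +oo)%E) ->
  simplex R k p -> simplex R k r -> 0 < s -> 0 < t -> s + t = 1 ->
  universally_equivalent L1 L2 (s *: p + t *: r) ->
  (t * gap L1 r <= s * gap L1 p) <-> (t * gap L2 r <= s * gap L2 p).
Proof.
move=> L1b L2b L1f L2f [p0 p1] [r0 r1] s0 t0 st.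
pose m (c : bool) y := if c then s * p ord0 y else t * r ord0 y.
have m0 c y : 0 <= m c y by case: c; rewrite mulr_ge0// ltW.
have -> : s *: p + t *: r = \row_y (m true y + m false y).
  by apply/rowP => y; rewrite !mxE.
have spi : simplex R k (\row_y (m true y + m false y)).
  split=> [y|]; first by rewrite mxE addr_ge0.
  by under eq_bigr do rewrite mxE; rewrite big_split/= -!mulr_sumr p1 r1 !mulr1.
have mt : \sum_y m true y = s by rewrite -mulr_sumr p1 mulr1.
have mf : \sum_y m false y = t by rewrite -mulr_sumr r1 mulr1.
have pE : \row_y (m true y / s) = p.
  by apply/rowP => y; rewrite mxE mulrC mulKf// gt_eqF.
have rE : \row_y (m false y / t) = r.
  by apply/rowP => y; rewrite mxE mulrC mulKf// gt_eqF.
have infoE L : bounded_below L ->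
    (forall p, simplex R k p -> (entropy L p < +oo)%E) ->
    (information (\row_y (m true y + m false y)%R) (coin_law m) (entropy L)
      (erase_branch true) <=
     information (\row_y (m true y + m false y)%R) (coin_law m) (entropy L)
      (erase_branch false))%E = (t * gap L r <= s * gap L p).
  move=> Lb Lf; rewrite !information_coin ?mf ?mt ?pE ?rE//= lee_fin.
  have E u (v : 'rV[R]_k) :
      \sum_(y < k) u * v ord0 y *
        fine (entropy L (delta_mx ord0 y)) =
      u * \sum_(y < k) v ord0 y * fine (entropy L (delta_mx ord0 y)).
    by rewrite mulr_sumr; apply: eq_bigr => y _; rewrite mulrA.
  by rewrite !E /gap !mulrBr; apply/idP/idP; lra.
rewrite -(infoE L1 L1b L1f) -(infoE L2 L2b L2f) => ue.
by apply: ue; exact: measurable_erase_branch.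
Qed.

End concavity_gap.

(** The comparisons see the ratio [f x / f y] through the thresholds
    [t / s].  The point [x0] makes the zero sets of [f] and [g] agree.
    If [g r] and [g x] are positive, weights proportional to [g r] at [x] and
    to [g x] at [r] make the two sides equal for [g], hence for [f] too. *)
Lemma proportional_of_compare (R : realFieldType) (T : Type) (A : set T)
    (f g : T -> R) (x0 : T) :
  (forall x, A x -> 0 <= f x) -> (forall x, A x -> 0 <= g x) ->
  A x0 -> f x0 = 0 -> g x0 = 0 ->
  (forall x y (s t : R), A x -> A y -> 0 < s -> 0 < t -> s + t = 1 ->
    (t * f y <= s * f x) <-> (t * g y <= s * g x)) ->
  exists2 a : R, 0 < a & forall x, A x -> f x = a * g x.
Proof.
move=> f0 g0 Ax0 fx0 gx0 fg.
have zero x : A x -> (f x == 0) = (g x == 0).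
  move=> Ax; have h0 : (0 : R) < 1 / 2 by rewrite divr_gt0.
  have := fg x0 x _ _ Ax0 Ax h0 h0 (esym (splitr 1)).
  rewrite fx0 gx0 !mulr0 !pmulr_rle0// => H.
  by rewrite !eq_le f0// g0// !andbT; apply/idP/idP => /H.
have [[r Ar gr]|none] := pselect (exists2 r, A r & g r != 0); last first.
  exists 1 => // x Ax; have gx : g x == 0.
    by apply: contra_notT none => gx; exists x.
  by have := gx; rewrite -zero// (eqP gx) mulr0 => /eqP.
have gr0 : 0 < g r by rewrite lt0r gr g0.
have fr0 : 0 < f r by rewrite lt0r zero// gr f0.
exists (f r / g r) => [|x Ax]; first by rewrite divr_gt0.
have [gx|gx] := eqVneq (g x) 0.
  by rewrite gx mulr0; apply/eqP; rewrite zero// gx.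
have gx0' : 0 < g x by rewrite lt0r gx g0.
pose n := g x + g r; have n0 : 0 < n by rewrite addr_gt0.
have s0 : 0 < g r / n by rewrite divr_gt0.
have t0 : 0 < g x / n by rewrite divr_gt0.
have st : g r / n + g x / n = 1.
  by rewrite -mulrDl addrC divff// gt_eqF.
have ts : g x / n + g r / n = 1 by rewrite addrC.
have E : g x / n * g r = g r / n * g x by rewrite mulrAC (mulrC (g x)) mulrAC.
have le1 := (fg x r _ _ Ax Ar s0 t0 st).2; rewrite E lexx in le1.
have le2 := (fg r x _ _ Ar Ax t0 s0 ts).2; rewrite E lexx in le2.
have /eqP : g x / n * f r = g r / n * f x.
  by apply/eqP; rewrite eq_le le1// le2.
move=> /eqP /(congr1 (fun z => z * (n / g r))) H.
have -> : f x = g r / n * f x * (n / g r) by field; rewrite !gt_eqF.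
by rewrite -H; field; rewrite !gt_eqF.
Qed.

Theorem theorem1 (R : realType) (k : nat)
    (L1 L2 : 'rV[R]_k -> 'I_k -> \bar R)
    (L1_bounded : bounded_below L1) (L2_bounded : bounded_below L2)
    (L1_entropy_fin : forall pi, simplex R k pi -> (entropy L1 pi < +oo)%E)
    (L2_entropy_fin : forall pi, simplex R k pi -> (entropy L2 pi < +oo)%E) :
  (forall pi, simplex R k pi -> universally_equivalent L1 L2 pi)
  <->
  (exists (a : R) (b : 'rV[R]_k) (c : R),
     0 < a /\
     forall pi, simplex R k pi ->
       entropy L1 pi =
       (a%:E * entropy L2 pi
        + (\sum_(y < k) b ord0 y * pi ord0 y + c)%:E)%E).
Proof.
split=> [ue|[a [b [c [a0 HE]]]] pi spi]; last first.
  move=> d T P d1 Z1 q1 d2 Z2 q2 mq1 mq2.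
  have infoE := information_affine _ spi _ L2_bounded L2_entropy_fin HE.
  by rewrite (infoE _ _ P _ _ q1 mq1) (infoE _ _ P _ _ q2 mq2) lee_pmul2l.
have [k0|k0] := posnP k.
  exists 1, 0, 0; split=> // p [_]; subst k; rewrite big_ord0.
  by move=> /eqP; rewrite eq_sym oner_eq0.
pose e := delta_mx ord0 (Ordinal k0) : 'rV[R]_k.
have [||||||a a0 gapE] := @proportional_of_compare R _ (simplex R k)
    (gap L1) (gap L2) e.
- by move=> p sp; exact: gap_ge0.
- by move=> p sp; exact: gap_ge0.
- exact: delta_simplex.
- exact: gap_delta.
- exact: gap_delta.
- move=> p r s t sp sr s0 t0 st; apply: (universally_equivalent_gap
    L1_bounded L2_bounded L1_entropy_fin L2_entropy_fin sp sr s0 t0 st).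
  apply: ue; case: sp => p0 p1; case: sr => r0 r1.
  split=> [y|]; first by rewrite !mxE addr_ge0// mulr_ge0// ltW.
  under eq_bigr do rewrite !mxE.
  by rewrite big_split/= -!mulr_sumr p1 r1 !mulr1.
(* Equal gaps up to [a] mean that [H1 - a H2] is its own interpolation at the
   vertices, which gives the coefficients. *)
exists a, (\row_y (fine (entropy L1 (delta_mx ord0 y))
                   - a * fine (entropy L2 (delta_mx ord0 y)))), 0.
split=> // p sp; have := gapE _ sp; rewrite /gap.
move=> /(canRL (subrK _)) H1.
rewrite -(fine_entropyK L1_bounded L1_entropy_fin sp).
rewrite -(fine_entropyK L2_bounded L2_entropy_fin sp) H1 -EFinM -EFinD.
congr EFin; rewrite addr0 mulrBr -addrA; congr (_ + _).
rewrite mulr_sumr addrC -sumrB; apply: eq_bigr => y _; rewrite mxE; ring.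
Qed.
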